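(* Let $s\ge 2$ and $t\ge2$ be integers. If $K_s$ has a phase transition from $\mathbf{Q}(t,n)$ to $\mathbf{Q}(t+1,n)$, then $K_s$ has a weak phase transition at $\mathbf{Q}(t,n)$.
   Context: All graphs are simple and logarithms are base $2$. For integers $t\ge2$, $\mathbf{Q}(t,n)$ is the minimum independence number over all $K_t$-free graphs on $n$ vertices. For a graph $H$ and a function $f$, $\mathbf{RT}(n,H,f(n))$ denotes the maximum number of edges of an $H$-free graph on $n$ vertices with independence number less than $f(n)$ (taken to be $0$ if no such graph exists). Set $\overline{\rho\tau}(H,f)=\limsup_{n\to\infty}\mathbf{RT}(n,H,f(n))/n^2$ and $\underline{\rho\tau}(H,f)=\liminf_{n\to\infty}\mathbf{RT}(n,H,f(n))/n^2$. Phase transitions: given a graph $H$ and functions $g(n)\le f(n)$, $H$ has a phase transition from $f$ to $g$ if $\overline{\rho\tau}(H,g)<\underline{\rho\tau}(H,f)$. Given a function $\varphi(n)\to0$, $H$ has a $\varphi$-phase-transition at $f$ if $H$ has a phase transition from $f$ to $\varphi f$. $H$ has a weak phase transition at $f$ if there exists $\varepsilon>0$ such that $H$ has a $\varphi$-phase-transition at $f$ for $\varphi(n)=2^{-(\log n)^{1-\varepsilon}}$. *)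

(* Defs.v *)
From HB Require Import structures.
From mathcomp Require Import all_boot all_order all_algebra.
From mathcomp Require Import all_classical all_reals all_analysis.

Set Implicit Arguments.
Unset Strict Implicit.
Unset Printing Implicit Defensive.

Import Order.TTheory GRing.Theory Num.Theory.
Import numFieldNormedType.Exports.

Local Open Scope classical_set_scope.
Local Open Scope ring_scope.

(* A simple graph on V is its set of edges, each a 2-element subset of V;
   hence #|edges G| counts unordered edges. *)
Record sgraph (V : finType) := SGraph {
  edges : {set {set V}};
  edges_card2 : [forall e in edges, #|e| == 2%N] }.

HB.instance Definition _ (V : finType) := [isSub for @edges V].
HB.instance Definition _ (V : finType) := [Finite of sgraph V by <:].

Definition adj (V : finType) (G : sgraph V) (x y : V) : bool :=
  [set x; y]%SET \in edges G.

Definition independent (V : finType) (G : sgraph V) (S : {set V}) : bool :=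
  [forall x in S, forall y in S, ~~ adj G x y].

Definition alpha (V : finType) (G : sgraph V) : nat :=
  \max_(S : {set V} | independent G S) #|S|.

Lemma complete_edges_card2 (V : finType) :
  [forall e in [set e : {set V} | #|e| == 2%N]%SET, #|e| == 2%N].
Proof. by apply/forallP => e; apply/implyP; rewrite inE. Qed.

Definition complete (V : finType) : sgraph V := SGraph (complete_edges_card2 V).

Definition K (s : nat) : sgraph 'I_s := complete 'I_s.

(* The image of H need not be an induced subgraph of G. *)
Definition contains (W V : finType) (H : sgraph W) (G : sgraph V) : bool :=
  [exists f : {ffun W -> V},
    injectiveb f && [forall x, forall y, adj H x y ==> adj G (f x) (f y)]].

Definition subgraph_free (W V : finType) (H : sgraph W) (G : sgraph V) : bool :=
  ~~ contains H G.

(* The default value n is harmless: alpha G <= n for every G, and for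
   2 <= t the edgeless graph is K_t-free, so the minimum is attained. *)
Definition Q (t n : nat) : nat :=
  \big[minn/n]_(G : sgraph 'I_n | subgraph_free (K t) G) alpha G.

(* An empty maximum is 0. *)
Definition RT (R : realType) (n : nat) (W : finType) (H : sgraph W) (x : R)
    : nat :=
  \max_(G : sgraph 'I_n | subgraph_free H G && ((alpha G)%:R < x)) #|edges G|.

Definition RT_density (R : realType) (W : finType) (H : sgraph W)
    (f : nat -> R) (n : nat) : \bar R :=
  ((RT n H (f n))%:R / (n%:R ^+ 2))%:E.

Definition rhotau_sup (R : realType) (W : finType) (H : sgraph W)
    (f : nat -> R) : \bar R := limn_esup (RT_density H f).

Definition rhotau_inf (R : realType) (W : finType) (H : sgraph W)
    (f : nat -> R) : \bar R := limn_einf (RT_density H f).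

Definition phase_transition (R : realType) (W : finType) (H : sgraph W)
    (f g : nat -> R) : Prop :=
  (forall n, g n <= f n) /\ (rhotau_sup H g < rhotau_inf H f)%E.

Definition phi_phase_transition (R : realType) (W : finType) (H : sgraph W)
    (phi f : nat -> R) : Prop :=
  phi n @[n --> \oo] --> (0 : R) /\
  phase_transition H f (fun n => phi n * f n).

Definition log2 (R : realType) (x : R) : R := ln x / ln 2.

Definition weak_phi (R : realType) (eps : R) (n : nat) : R :=
  2 `^ (- (log2 (n%:R : R) `^ (1 - eps))).

(* The requirement weak_phi eps --> 0 inside phi_phase_transition forces
   eps < 1. *)
Definition weak_phase_transition (R : realType) (W : finType) (H : sgraph W)
    (f : nat -> R) : Prop :=
  exists eps : R, 0 < eps /\ phi_phase_transition H (weak_phi eps) f.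

(* Main.v *)
Require Import Defs.
From mathcomp Require Import all_boot all_order all_algebra.
From mathcomp Require Import all_classical all_reals all_analysis.
From mathcomp Require Import zify lra ring.
Import Order.TTheory GRing.Theory Num.Theory.
Import numFieldNormedType.Exports.
Local Open Scope ring_scope.

(* Let [k = (s - 1) %/ t], the trivial case [k = 0] being treated as [k = 1]. If [k >= 2],
   joining [k] copies of an optimal [K_(t+1)]-free graph shows that the upper density at
   [Q(t+1, n)] is at least [(1 - 1/k) / 2]; so it suffices to bound the upper density at
   [phi * Q(t, n)] by the same number. Under the latter independence bound every set of
   [n^(1 - o(1))] vertices contains [K_t], because [Q t] is subadditive. A graph with
   [(1 - 1/k + d) n^2 / 2] edges has a positive proportion of [(k+1)]-cliques. Regard these
   as a bipartite graph between vertices and [k]-cliques: dependent random choice gives a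
   set of [n^(1 - o(1))] vertices in which every [t]-set, in particular some [K_t], is
   completely joined to [n^(k - o(1))] of the [k]-cliques. Iterating, one peels off [k + 1]
   mutually joined copies of [K_t], hence [K_s]. *)

Set Implicit Arguments.
Unset Strict Implicit.

(** * Graphs, cliques and the function Q *)


Section Graphs.
Local Open Scope nat_scope.
Implicit Types (V W : finType) (k s t n m r : nat).

Lemma adjC V (G : sgraph V) x y : adj G x y = adj G y x.
Proof. by rewrite /adj finset.setUC. Qed.

Lemma adj_neq V (G : sgraph V) x y : adj G x y -> x != y.
Proof.
move=> xy; have /forallP/(_ [set x; y]%SET)/implyP/(_ xy) := edges_card2 G.
by rewrite cards2; case: (x != y).
Qed.

Lemma adjxx V (G : sgraph V) x : adj G x x = false.
Proof. by apply/negP => /adj_neq; rewrite eqxx. Qed.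

Definition rel_edges V (r : rel V) : {set {set V}} :=
  [set e : {set V} | [exists x, exists y,
     [&& x != y, r x y & e == [set x; y]%SET]]]%SET.

Lemma rel_edges_card2 V (r : rel V) : [forall e in rel_edges r, #|e| == 2].
Proof.
apply/forallP => e; apply/implyP; rewrite inE.
by case/existsP => x /existsP[y /and3P[xy _ /eqP->]]; rewrite cards2 xy.
Qed.

Definition graph_of V (r : rel V) : sgraph V := SGraph (rel_edges_card2 r).

Lemma adj_graph_of V (r : rel V) x y :
  symmetric r -> adj (graph_of r) x y = (x != y) && r x y.
Proof.
move=> rC; rewrite /adj /= inE; apply/idP/idP; last first.
  move=> /andP[xy rxy]; apply/existsP; exists x; apply/existsP; exists y.
  by rewrite xy rxy /=.
move=> /existsP[a /existsP[b /and3P[ab rab /eqP xyab]]].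
have xy : x != y.
  by have := cards2 x y; rewrite xyab cards2 ab; case: (x != y).
have xab : x \in [set a; b]%SET by rewrite -xyab !inE eqxx.
have yab : y \in [set a; b]%SET by rewrite -xyab !inE eqxx orbT.
move: xab yab xy; rewrite !inE.
by case/orP => /eqP-> /orP[]/eqP->; rewrite ?eqxx // => ->; rewrite // rC.
Qed.

Definition is_clique V (G : sgraph V) (S : {set V}) : Prop :=
  {in S &, forall x y, x != y -> adj G x y}.

Lemma ord_inj_set V (U : {set V}) n :
  n <= #|U| -> exists2 f : 'I_n -> V, injective f & forall i, f i \in U.
Proof.
move=> nU; exists (fun i => enum_val (widen_ord nU i)) => [i j|i].
  by move=> /enum_val_inj/(congr1 val)/= /val_inj.
exact: enum_valP.
Qed.

Lemma contains_KP V (G : sgraph V) t :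
  reflect (exists2 S, is_clique G S & t <= #|S|) (contains (K t) G).
Proof.
apply: (iffP existsP) => [[f /andP[/injectiveP finj /forallP fadj]]|[S Scl tS]].
  exists [set f x | x in 'I_t]%SET; last by rewrite card_imset// card_ord.
  move=> _ _ /imsetP[x _ ->] /imsetP[y _ ->] fxy.
  have /forallP/(_ y)/implyP := fadj x; apply; rewrite /adj inE cards2.
  by case: (x =P y) fxy => [->|]; rewrite ?eqxx.
have [f finj fS] := ord_inj_set tS.
exists [ffun i => f i]; apply/andP; split.
  by apply/injectiveP => x y; rewrite !ffunE => /finj.
apply/forallP => x; apply/forallP => y; apply/implyP => /adj_neq xy.
by rewrite !ffunE; apply: Scl; rewrite ?fS// (inj_eq finj).
Qed.

Lemma free_KP V (G : sgraph V) t :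
  reflect (forall S, is_clique G S -> #|S| < t) (subgraph_free (K t) G).
Proof.
apply: (iffP negP) => [nK S Scl|h /contains_KP[S /h]].
  by rewrite ltnNge; apply/negP => tS; apply: nK; apply/contains_KP; exists S.
by rewrite ltnNge => /negP.
Qed.

Lemma independentP V (G : sgraph V) (S : {set V}) :
  reflect {in S &, forall x y, ~~ adj G x y} (independent G S).
Proof.
apply: (iffP forallP) => [h x y xS yS|h x].
  by have /implyP/(_ xS)/forallP/(_ y)/implyP/(_ yS) := h x.
by apply/implyP => xS; apply/forallP => y; apply/implyP; apply: h.
Qed.

Lemma alpha_leP V (G : sgraph V) a :
  reflect (forall S, independent G S -> #|S| <= a) (alpha G <= a).
Proof. exact: bigmax_leqP. Qed.

Lemma independent_leq_alpha V (G : sgraph V) S :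
  independent G S -> #|S| <= alpha G.
Proof. exact: leq_bigmax_cond. Qed.

Lemma alpha_leq_card V (G : sgraph V) : alpha G <= #|V|.
Proof. by apply/alpha_leP => S _; apply: max_card. Qed.

Lemma Q_leq t n (G : sgraph 'I_n) : subgraph_free (K t) G -> Q t n <= alpha G.
Proof.
move=> free.
by have := bigmin_le_cond n (@alpha _) free; rewrite minEnat leEnat.
Qed.

Lemma Q_attained t n : 2 <= t ->
  exists2 G : sgraph 'I_n, subgraph_free (K t) G & alpha G = Q t n.
Proof.
move=> t2; pose E := graph_of (fun _ _ : 'I_n => false).
have Efree : subgraph_free (K t) E.
  apply/free_KP => S Scl; rewrite (leq_ltn_trans _ t2)//.
  apply/card_le1_eqP => x y xS yS; apply/eqP; apply: contraT => xy.
  by move/Scl: xy => /(_ yS xS); rewrite adj_graph_of// andbF.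
have [|G Gfree QE] := eq_bigmin (x := n) E _ (@alpha _) Efree.
  by move=> G _; rewrite leEnat (leq_trans (alpha_leq_card G))// card_ord.
by exists G.
Qed.

(** [f] need not be injective on all of [V]: two clique vertices with the same image would give a
    loop in [H]. *)
Lemma clique_image V W (G : sgraph V) (H : sgraph W) (f : V -> W) (S : {set V}) :
  {in S &, forall x y, adj G x y -> adj H (f x) (f y)} -> is_clique G S ->
  is_clique H (f @: S) /\ #|f @: S| = #|S|.
Proof.
move=> fadj Scl; split.
  move=> _ _ /imsetP[x xS ->] /imsetP[y yS ->] fxy; apply: fadj => //.
  by apply: Scl => //; apply: contra fxy => /eqP->.
apply: card_in_imset => x y xS yS fxy; apply/eqP; apply: contraT => xy.
by have /adj_neq := fadj _ _ xS yS (Scl _ _ xS yS xy); rewrite fxy eqxx.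
Qed.

Lemma leq_card_fibers V W (p : V -> W) (S : {set V}) a :
  (forall i, #|[set x in S | p x == i]| <= a) -> #|S| <= #|W| * a.
Proof.
move=> h; rewrite -sum1_card (partition_big p xpredT)//= -sum_nat_const.
apply: leq_sum => i _; apply: leq_trans (h i).
by rewrite -sum1_card; apply: eq_leq; apply: eq_bigl => x; rewrite inE.
Qed.

Definition comap V W (G : sgraph V) (f : W -> V) : sgraph W :=
  graph_of (fun x y => adj G (f x) (f y)).

Lemma adj_comap V W (G : sgraph V) (f : W -> V) x y :
  adj (comap G f) x y = adj G (f x) (f y).
Proof.
rewrite adj_graph_of; last by move=> a b; rewrite adjC.
by case: eqP => // ->; rewrite adjxx.
Qed.

Lemma alpha_comap V W (G : sgraph V) (f : W -> V) :
  injective f -> alpha (comap G f) <= alpha G.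
Proof.
move=> finj; apply/alpha_leP => S /independentP Sind.
rewrite -(card_imset _ finj); apply: independent_leq_alpha.
apply/independentP => _ _ /imsetP[x xS ->] /imsetP[y yS ->].
by rewrite -adj_comap; apply: Sind.
Qed.

(** Transfers [Q] from graphs on ['I_n] to subsets of any graph: pull [G] back along an injection of
    ['I_n] into [U]. *)
Lemma Q_leq_alpha V (G : sgraph V) (U : {set V}) t n : n <= #|U| ->
  (forall S : {set V}, S \subset U -> is_clique G S -> #|S| < t) ->
  Q t n <= alpha G.
Proof.
move=> /ord_inj_set[f finj fU] h.
apply: leq_trans (alpha_comap _ finj); apply: Q_leq; apply/free_KP => S Scl.
have [|fScl <-] := clique_image (H := G) (f := f) _ Scl.
  by move=> x y _ _; rewrite adj_comap.
by apply: h => //; apply/fintype.subsetP => _ /imsetP[x _ ->].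
Qed.

Lemma Q_mono t m n : 2 <= t -> m <= n -> Q t m <= Q t n.
Proof.
move=> t2 mn; have [G /free_KP free <-] := Q_attained n t2.
apply: (Q_leq_alpha (U := [set: 'I_n]%SET)) => [|S _].
  by rewrite cardsT card_ord.
exact: free.
Qed.

(** Take [r] disjoint copies of an optimal graph on [u] vertices: a clique lies in one copy, and an
    independent set meets each copy in at most [Q t u] vertices. *)
Lemma Q_subadd t n r u : 2 <= t -> n <= r * u -> Q t n <= r * Q t u.
Proof.
move=> t2 nru; have [H /free_KP free <-] := Q_attained u t2.
pose G := graph_of (fun x y : 'I_r * 'I_u => (x.1 == y.1) && adj H x.2 y.2).
have Gadj x y : adj G x y = (x.1 == y.1) && adj H x.2 y.2.
  rewrite adj_graph_of; last by move=> a b; rewrite eq_sym adjC.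
  by case: eqP => // ->; rewrite adjxx andbF.
apply: (@leq_trans (alpha G)).
  apply: (Q_leq_alpha (U := [set: 'I_r * 'I_u]%SET)) => [|S _ Scl].
    by rewrite cardsT card_prod !card_ord.
  have [|Scl' <-] := clique_image (H := H) (f := snd) _ Scl; last exact: free.
  by move=> x y _ _; rewrite Gadj => /andP[].
apply/alpha_leP => S /independentP Sind.
have := @leq_card_fibers _ 'I_r fst S (alpha H); rewrite card_ord; apply => i.
rewrite -(card_in_imset (f := snd)).
  apply: independent_leq_alpha.
  apply/independentP => _ _ /imsetP[x + ->] /imsetP[y + ->].
  rewrite !inE => /andP[xS /eqP xi] /andP[yS /eqP yi].
  by have := Sind _ _ xS yS; rewrite Gadj xi yi eqxx.
move=> [x1 x2] [y1 y2]; rewrite !inE /= => /andP[_ /eqP->] /andP[_ /eqP->].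
by move=> ->.
Qed.

(** Erdős-Szekeres induction on [a + b], splitting [U] into neighbours and non-neighbours of a
    vertex. The crude bound is enough to show that [Q t] is unbounded. *)
Lemma ramsey V (G : sgraph V) a b (U : {set V}) : 2 ^ (a + b) <= #|U| ->
  (exists S : {set V}, [/\ S \subset U, is_clique G S & #|S| = a]) \/
  (exists S : {set V}, [/\ S \subset U, independent G S & #|S| = b]).
Proof.
have [N] := ubnP (a + b); elim: N a b U => // N IH [|a] [|b] U; rewrite ltnS.
- by left; exists finset.set0; rewrite cards0 finset.sub0set; split=> // x; rewrite inE.
- by left; exists finset.set0; rewrite cards0 finset.sub0set; split=> // x; rewrite inE.
- right; exists finset.set0; rewrite cards0 finset.sub0set; split=> //.
  by apply/independentP => x; rewrite inE.
move=> abN Ucard.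
have /card_gt0P[v vU] : 0 < #|U| by apply: leq_trans Ucard; rewrite expn_gt0.
pose A := [set x in U | adj G v x]%SET.
pose B := ((U :\ v) :\: A)%SET.
have AB : #|U| <= (#|A| + #|B|).+1.
  rewrite (cardsD1 v U) vU -(cardsID A (U :\ v)) add1n ltnS leq_add2r.
  by apply: subset_leq_card; apply: finset.subsetIr.
have AU : A \subset U by apply/fintype.subsetP => x; rewrite inE => /andP[].
have BU : B \subset U.
  by apply/fintype.subsetP => x; rewrite !inE => /andP[_ /andP[]].
have [Abig|Asmall] := leqP (2 ^ (a + b.+1)) #|A|.
  have [|[S [SA Scl Sa]]|[S [SA Sind Sb]]] := IH _ _ _ _ Abig.
  - by move: abN; lia.
  - left; exists (v |: S)%SET; split.
    + by rewrite finset.subUset finset.sub1set vU (fintype.subset_trans SA AU).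
    + have vS x : x \in S -> adj G v x.
        by move/(fintype.subsetP SA); rewrite inE => /andP[].
      move=> x y /setU1P[->|xS] /setU1P[->|yS]; rewrite ?eqxx// => xy.
      - exact: vS.
      - by rewrite adjC; apply: vS.
      - exact: Scl.
    + rewrite cardsU1 Sa; case: (boolP (v \in S)) => // /(fintype.subsetP SA).
      by rewrite inE adjxx andbF.
  - by right; exists S; split=> //; apply: fintype.subset_trans SA AU.
have Bbig : 2 ^ (a.+1 + b) <= #|B|.
  move: Ucard AB Asmall; rewrite addSnnS -addSnnS addnS expnS addSnnS; lia.
have [|[S [SB Scl Sa]]|[S [SB Sind Sb]]] := IH _ _ _ _ Bbig.
- by move: abN; lia.
- by left; exists S; split=> //; apply: fintype.subset_trans SB BU.
right; exists (v |: S)%SET; split.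
+ by rewrite finset.subUset finset.sub1set vU (fintype.subset_trans SB BU).
+ have vS x : x \in S -> ~~ adj G v x.
    move/(fintype.subsetP SB); rewrite !inE => /andP[+ /andP[_ xU]].
    by rewrite xU.
  apply/independentP => x y /setU1P[->|xS] /setU1P[->|yS].
  - by rewrite adjxx.
  - exact: vS.
  - by rewrite adjC; apply: vS.
  - by have /independentP := Sind; apply.
+ rewrite cardsU1 Sb; case: (boolP (v \in S)) => // /(fintype.subsetP SB).
  by rewrite !inE eqxx andbF.
Qed.

Lemma Q_unbounded t b : 2 <= t -> exists n, b <= Q t n.
Proof.
move=> t2; exists (2 ^ (t + b)); have [G /free_KP free <-] := Q_attained (2 ^ (t + b)) t2.
have [|[S [_ /free Scl St]]|[S [_ Sind Sb]]] :=
  ramsey G (a := t) (b := b) (U := [set: _]%SET).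
- by rewrite cardsT card_ord.
- by rewrite St ltnn in Scl.
by apply: leq_trans (independent_leq_alpha Sind); rewrite Sb.
Qed.

(** Handshake lemma: group the ordered adjacent pairs by their edge; each edge has two orderings. *)
Lemma sum_adj V (G : sgraph V) :
  \sum_(x : V) #|[set y | adj G x y]%SET| = 2 * #|edges G|.
Proof.
transitivity (\sum_(p : V * V | adj G p.1 p.2) 1).
  rewrite -(pair_big_dep xpredT (fun x y => adj G x y) (fun _ _ => 1)) /=.
  by apply: eq_bigr => x _; rewrite sum1_card; apply: eq_card => y; rewrite inE.
rewrite (partition_big (fun p => [set p.1; p.2]%SET) (mem (edges G)))//=.
rewrite mulnC -sum_nat_const; apply: eq_bigr => e eG.
have /cards2P[x [y [xy eE]]] : #|e| == 2.
  by have /forallP/(_ e)/implyP/(_ eG) := edges_card2 G.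
rewrite sum1_card -[RHS](_ : #|[set (x, y); (y, x)]%SET| = 2); last first.
  by rewrite cards2 xpair_eqE (negPf xy).
apply: eq_card => -[a b]; rewrite [in RHS]inE /= !inE /= !xpair_eqE.
rewrite unfold_in /= /adj.
apply/andP/idP => [[_ /eqP abe]|].
  have ab : a != b by have := cards2 a b; rewrite abe eE cards2 xy; case: eqP.
  have : a \in [set x; y]%SET by rewrite -eE -abe !inE eqxx.
  have : b \in [set x; y]%SET by rewrite -eE -abe !inE eqxx orbT.
  rewrite !inE => /orP[]/eqP bE /orP[]/eqP aE;
    by move: ab; rewrite aE bE ?eqxx ?orbT.
rewrite eE in eG *.
by case/orP => /andP[/eqP-> /eqP->]; rewrite ?eG ?[[set y; x]%SET]finset.setUC.
Qed.
End Graphs.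

(** * Dependent random choice *)


Section Drc.
Local Open Scope nat_scope.

Lemma leq_bin_expn n k : 'C(n, k) <= n ^ k.
Proof.
rewrite -(leq_pmul2r (fact_gt0 k)) bin_ffact.
apply: (@leq_trans (n ^ k)); last by rewrite leq_pmulr// fact_gt0.
rewrite ffact_prod -[k in n ^ k]card_ord -prod_nat_const.
by apply: leq_prod => i _; apply: leq_subr.
Qed.

Lemma leq_expr2 a b m : a <= b -> a ^ m <= b ^ m.
Proof. by case: m => // m; rewrite leq_exp2r. Qed.

(* A random tuple of [m] elements of [B] has a large common neighbourhood, and
   rarely lies in the common neighbourhood of a [t]-set for which that is small. *)
Lemma dependent_random_choice (A B : finType) (e : A -> B -> bool)
    (P : {set A} -> Prop) (t u x y m : nat) :
  (forall U : {set A}, u <= #|U| ->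
     exists S : {set A}, [/\ S \subset U, P S & #|S| = t]) ->
  #|A| * #|B| <= 2 ^ y * \sum_a #|[set b | e a b]%SET| ->
  u * 2 ^ (y.+1 * m.+1).+1 < #|A| ->
  #|A| ^ t * 2 ^ (y.+1 * m.+1).+1 <= 2 ^ (x * m) ->
  exists S : {set A}, [/\ P S, #|S| = t &
    #|B| <= 2 ^ x * #|[set b | [forall a in S, e a b]]%SET|].
Proof.
move=> largeP edens uA tA; apply/not_existsP => nS.
pose cn (S : {set A}) := [set b | [forall a in S, e a b]]%SET.
pose d a := #|[set b | e a b]%SET|.
(* Expectations over a random [T] are replaced by sums over all [m]-tuples. If the claim fails,
   every [t]-set with [P] is in [Bad]. *)
pose N (T : {ffun 'I_m -> B}) := [set a | [forall i, e a (T i)]]%SET.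
pose Bad := [set S : {set A} | (#|S| == t) && (2 ^ x * #|cn S| < #|B|)]%SET.
have PBad S : P S -> #|S| = t -> S \in Bad.
  move=> PS St; rewrite inE St eqxx /= ltnNge; apply/negP => h.
  by apply: (nS S); split.
have B0 : 0 < #|B|.
  have [|S [_ PS St]] := largeP [set: A]%SET.
    rewrite cardsT; apply: leq_trans (ltnW uA); rewrite leq_pmulr// expn_gt0//.
  by have := PBad _ PS St; rewrite inE => /andP[_]; apply: leq_trans.
(* Vertices of at least half the average degree guaranteed by the density [2^-y]. *)
pose A' := [set a | #|B| <= 2 ^ y.+1 * d a]%SET.
have A'large : #|A| <= 2 ^ y.+1 * #|A'|.
  rewrite -(leq_pmul2r B0).
  have : 2 ^ y.+1 * (\sum_a d a) <= 2 ^ y.+1 * #|A'| * #|B| + #|A| * #|B|.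
    rewrite -mulnA -!sum_nat_const (bigID (mem A'))/= mulnDr leq_add//.
      rewrite leq_mul2l leq_sum ?orbT// => a _; apply: max_card.
    rewrite big_distrr/= big_mkcond/=; apply: leq_sum => a _.
    by case: ifPn => //; rewrite inE -ltnNge => /ltnW.
  move: edens; rewrite -/d expnS; set s := bigop _ _ _; lia.
(* Double counting gives [d a ^ m] tuples [T] with [a] in [N T]; keep only the [a] in [A']. *)
have Nlow : #|A'| * #|B| ^ m <= 2 ^ (y.+1 * m) * \sum_T #|N T|.
  have -> : \sum_T #|N T| = \sum_a d a ^ m.
    transitivity (\sum_(T : {ffun 'I_m -> B}) \sum_a ([forall i, e a (T i)] : nat)).
      by apply: eq_bigr => T _; rewrite -sum1_card big_mkcond /=;
        apply: eq_bigr => a _; rewrite inE; case: ifP.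
    rewrite exchange_big /=; apply: eq_bigr => a _.
    rewrite /d -[m in _ ^ m]card_ord -card_ffun_on -sum1_card.
    rewrite [RHS]big_mkcond /=; apply: eq_bigr => T _.
    rewrite (_ : (T \in _) = [forall i, e a (T i)]); first by case: ifP.
    by apply/ffun_onP/forallP => h i; have := h i; rewrite inE.
  rewrite big_distrr -sum_nat_const big_mkcond /=; apply: leq_sum => a _.
  by case: ifP => // ; rewrite inE expnM -expnMn => h; rewrite leq_expr2.
(* An [N T] with at least [u] vertices contains a bad set, so it is charged [#|A|] per bad set
   inside it. A bad [S] lies in [N T] only when [T] takes values in [cn S], a fraction of at most
   [2^-(x m)] of the tuples, and there are at most [#|A| ^ t] bad sets. *)
have Nup : 2 ^ (x * m) * (\sum_T #|N T|) <=
    (2 ^ (x * m) * u + #|A| ^ t * #|A|) * #|B| ^ m.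
  have NT T : #|N T| <= u + #|A| * #|[set S in Bad | S \subset N T]%SET|.
    have [/ltnW h|h] := ltnP #|N T| u; first by apply: leq_trans h (leq_addr _ _).
    have [S [SN PS St]] := largeP _ h.
    apply: leq_trans (leq_addl _ _); apply: leq_trans (max_card _) _.
    rewrite leq_pmulr// card_gt0; apply/set0Pn; exists S.
    by rewrite inE SN PBad.
  apply: (@leq_trans (2 ^ (x * m) * (u * #|B| ^ m + #|A| * \sum_(S in Bad) #|cn S| ^ m))).
    rewrite leq_mul2l; apply/orP; right.
    have : \sum_T #|N T| <=
        \sum_T (u + #|A| * #|[set S in Bad | S \subset N T]%SET|).
      by apply: leq_sum => T _; exact: NT.
    move=> /leq_trans; apply.
    rewrite big_split /= sum_nat_const card_ffun card_ord mulnC leq_add2l.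
    rewrite -big_distrr leq_mul2l /=; apply/orP; right.
    rewrite (eq_bigr (fun T => \sum_(S in Bad) (S \subset N T : nat))); last first.
      move=> T _; rewrite -sum1_card big_mkcond [RHS]big_mkcond /=.
      by apply: eq_bigr => S _; rewrite inE; case: (S \in Bad) => //=; case: ifP.
    rewrite exchange_big /=; apply: leq_sum => S _.
    rewrite -[m in _ ^ m]card_ord -card_ffun_on -sum1_card.
    rewrite [leqRHS]big_mkcond /=; apply: leq_sum => T _.
    case: ifPn => [|/ffun_onP h]; first by case: (S \subset N T).
    case: (boolP (_ \subset _)) => // /fintype.subsetP SN; case: h => i.
    rewrite inE; apply/forallP => a; apply/implyP => /SN.
    by rewrite inE => /forallP.
  rewrite mulnDr mulnDl mulnA leq_add2l mulnCA [leqRHS]mulnAC [leqRHS]mulnC.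
  rewrite leq_mul2l; apply/orP; right; rewrite big_distrr /=.
  apply: leq_trans (_ : \sum_(S in Bad) #|B| ^ m <= _).
    apply: leq_sum => S; rewrite inE => /andP[_ /ltnW h].
    by rewrite expnM -expnMn leq_expr2.
  rewrite sum_nat_const leq_mul2r; apply/orP; right.
  apply: leq_trans (leq_bin_expn _ _); rewrite -card_draws.
  by apply: subset_leq_card; apply/fintype.subsetP => S; rewrite !inE => /andP[].
have Bm0 : 0 < #|B| ^ m by rewrite expn_gt0 B0.
set X := 2 ^ (x * m) in tA Nup.
pose M := 2 ^ (y.+1 * m.+1).
have X0 : 0 < X by rewrite expn_gt0.
have low : #|A| * #|B| ^ m <= M * \sum_T #|N T|.
  rewrite /M mulnS expnD -mulnA.
  apply: (@leq_trans (2 ^ y.+1 * (#|A'| * #|B| ^ m))).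
    by rewrite mulnA leq_mul2r A'large orbT.
  by rewrite leq_mul2l Nlow orbT.
(* The two numeric hypotheses make the first summand on the right less than, and the second at most,
   half of the left side. *)
have : X * #|A| <= M * (X * u + #|A| ^ t * #|A|).
  rewrite -(leq_pmul2r Bm0) -mulnA.
  apply: (leq_trans (leq_mul (leqnn _) low)).
  by rewrite mulnCA -mulnA leq_mul2l Nup orbT.
apply/negP; rewrite -ltnNge.
move: uA tA; rewrite !(expnS _ (y.+1 * m.+1)) -/M.
move: (M) (X) X0 {Nup low} => {}M {}X X0; move: (#|A|) (#|A| ^ t) => a b ua ba.
have : X * (u * (2 * M)) < X * a by rewrite ltn_pmul2l.
have : b * (2 * M) * a <= X * a by rewrite leq_mul2r ba orbT.
lia.
Qed.

Lemma card_set_sum (T : finType) (P : pred T) :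
  #|[set x | P x]%SET| = \sum_x P x.
Proof.
rewrite -sum1_card big_mkcond /=; apply: eq_bigr => x _.
by rewrite inE; case: (P x).
Qed.

Lemma sum_card_cons (V : finType) q (E : {set q.+1.-tuple V}) :
  \sum_v #|[set s : q.-tuple V | [tuple of v :: s] \in E]%SET| = #|E|.
Proof.
under eq_bigr do rewrite card_set_sum.
rewrite pair_bigA /= -sum1_card [RHS]big_mkcond /=.
rewrite (reindex (fun p : V * q.-tuple V => [tuple of p.1 :: p.2])) /=.
  by apply: eq_bigr => p _; case: (_ \in E).
exists (fun s : q.+1.-tuple V => (thead s, [tuple of behead s])) => [[v s] _|s _].
  by congr pair; apply: val_inj.
by rewrite /= -tuple_eta.
Qed.

(* [x j] is minus the logarithm of the density of [j]-cliques needed to peel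
   off the remaining [j] copies of [K_t]. *)
Lemma clique_blowup (V : finType) (G : sgraph V) (t u : nat) (x : nat -> nat) q :
  0 < t ->
  (forall U : {set V}, u <= #|U| ->
     exists S : {set V}, [/\ S \subset U, is_clique G S & #|S| = t]) ->
  (forall j, j < q -> exists m,
     u * 2 ^ ((x j.+1).+1 * m.+1).+1 < #|V| /\
     #|V| ^ t * 2 ^ ((x j.+1).+1 * m.+1).+1 <= 2 ^ (x j * m)) ->
  forall E : {set q.-tuple V},
    {in E, forall s : q.-tuple V, pairwise (adj G) s} ->
    #|V| ^ q <= 2 ^ x q * #|E| ->
  exists S : {set V}, [/\ is_clique G S, #|S| = t * q &
    {in S, forall v, exists2 s : q.-tuple V, s \in E & v \in s}].
Proof.
move=> t0 largeK; elim: q => [|q IH] xP E Ecl Edens.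
  by exists finset.set0; rewrite cards0 muln0; split => // v; rewrite inE.
have [m [um tm]] := xP q (leqnn _).
(* Vertex [v] is joined to the tuple [s] when [v :: s] is in [E]. The common neighbourhood [E'] of
   [S0] is again a dense family of cliques, to which the induction applies. *)
have [] := dependent_random_choice (A := V) (B := q.-tuple V)
  (e := fun v s => [tuple of v :: s] \in E) (y := x q.+1) largeK _ um tm.
  by rewrite card_tuple -expnS sum_card_cons.
move=> S0 [S0cl S0t]; rewrite card_tuple; set E' := finset _ => E'dens.
have E'P v s : v \in S0 -> s \in E' -> [tuple of v :: s] \in E.
  by rewrite inE => vS0 /forallP/(_ v)/implyP; apply.
have /card_gt0P[v0 v0S0] : 0 < #|S0| by rewrite S0t.
have [||S' [S'cl S't S'E]] := IH _ E' _ E'dens.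
- by move=> j jq; apply: xP; apply: ltnW.
- by move=> s /(E'P _ _ v0S0)/Ecl; rewrite /= => /andP[].
have V0 : 0 < #|V| by apply: leq_ltn_trans um.
have /card_gt0P[s0 s0E'] : 0 < #|E'|.
  rewrite -(@ltn_pmul2l (2 ^ x q)) ?expn_gt0// muln0.
  by rewrite (leq_trans _ E'dens)// expn_gt0 V0.
(* This is what the third conclusion is for: [w] lies in a tuple of [E'], which any [v] of [S0]
   extends to a clique tuple of [E]. *)
have joined v w : v \in S0 -> w \in S' -> adj G v w.
  move=> vS0 /S'E[s sE' ws]; have /Ecl := E'P _ _ vS0 sE'.
  by rewrite /= => /andP[/allP/(_ w ws)].
exists (S0 :|: S')%SET; split.
- move=> v w /setUP[] vS /setUP[] wS vw.
  + exact: S0cl.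
  + exact: joined.
  + by rewrite adjC; apply: joined.
  + exact: S'cl.
- rewrite cardsU (_ : S0 :&: S' = finset.set0)%SET ?cards0 ?S0t ?S't ?mulnS ?subn0//.
  apply/setP => v; rewrite !inE; apply/negP => /andP[vS0 vS'].
  by have := joined _ _ vS0 vS'; rewrite adjxx.
- move=> v /setUP[vS0|/S'E[s sE' vs]].
    by exists [tuple of v :: s0]; rewrite ?E'P// inE eqxx.
  by exists [tuple of v0 :: s]; rewrite ?E'P// inE vs orbT.
Qed.

End Drc.

(** * Supersaturation *)


Section Supersaturation.
Variable R : realType.

Section InGraph.
Variables (V : finType) (G : sgraph V).

Let deg (W : {set V}) v := (\sum_(y in W) adj G v y)%N.
Let pairs (W : {set V}) := (\sum_(x in W) deg W x)%N.

Lemma pairs_setD1 (W : {set V}) v : v \in W ->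
  pairs W = (pairs (W :\ v)%SET + 2 * deg W v)%N.
Proof.
move=> vW; have degD x : deg W x = (adj G x v + deg (W :\ v)%SET x)%N.
  by rewrite /deg (big_setD1 v).
rewrite /pairs (big_setD1 v)//= (eq_bigr _ (fun x _ => degD x)) big_split /=.
rewrite (_ : (\sum_(x in W :\ v) adj G x v)%N = deg (W :\ v)%SET v); last first.
  by apply: eq_bigr => x _; rewrite adjC.
by rewrite degD adjxx; lia.
Qed.

(* A set maximizing [pairs W - beta |W|^2] has no vertex of small degree. *)
Lemma min_degree_set (beta : R) : exists W : {set V},
  (pairs [set: V]%SET)%:R - beta * #|V|%:R ^+ 2 <= (pairs W)%:R - beta * #|W|%:R ^+ 2
  /\ {in W, forall v, beta * (#|W|%:R - 1 / 2) <= (deg W v)%:R}.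
Proof.
pose Phi (W : {set V}) : R := (pairs W)%:R - beta * #|W|%:R ^+ 2.
have [W _ Wmax] := @arg_maxP _ _ _ [set: V]%SET xpredT Phi isT.
exists W; split; first by have := Wmax [set: V]%SET isT; rewrite /Phi cardsT.
(* Deleting [v] lowers [pairs] by twice its degree and [#|W|^2] by [2 #|W| - 1], whence the
   [1 / 2]. *)
move=> v vW; have : Phi (W :\ v)%SET <= Phi W by apply: Wmax.
by rewrite /Phi (pairs_setD1 vW) (cardsD1 v W) vW natrD natrD natrM /=; lra.
Qed.

(** A vertex of [W] misses at most [f] vertices of [W], so the members of [s] together miss at most
    [size s * f]. *)
Lemma common_nbhd (W : {set V}) (f : R) (s : seq V) :
  {in W, forall v, #|W|%:R - f <= (deg W v)%:R} -> all (mem W) s ->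
  #|W|%:R - (size s)%:R * f <= #|[set v in W | all (adj G v) s]%SET|%:R.
Proof.
move=> degW; elim: s => [|w s IH] /= => [_|/andP[wW sW]].
  by rewrite mul0r subr0 (_ : finset _ = W)//; apply/setP => v; rewrite inE andbT.
have := degW _ wW; have := IH sW.
set A := finset _; set B := finset _.
suff : (#|A| + deg W w <= #|W| + #|B|)%N.
  rewrite -(ler_nat R) !natrD; lra.
rewrite (_ : deg W w = #|[set v in W | adj G w v]%SET|); last first.
  rewrite card_set_sum /deg big_mkcond /=; apply: eq_bigr => v _.
  by case: (v \in W).
rewrite -finset.cardsUI leq_add//; apply: subset_leq_card.
  by apply/fintype.subsetP => v; rewrite !inE => /orP[]/andP[].
apply/fintype.subsetP => v; rewrite !inE => /andP[/andP[-> sv] /andP[_ wv]].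
by rewrite adjC wv.
Qed.

Definition clique_tuples (W : {set V}) q : {set q.-tuple V} :=
  [set s : q.-tuple V | all (mem W) s && pairwise (adj G) s]%SET.

(** Greedy count: each clique tuple of length at most [k] extends by one vertex in at least [c]
    ways. *)
Lemma card_clique_tuples (W : {set V}) (c : R) k : 0 <= c ->
  (forall s : seq V, (size s <= k)%N -> all (mem W) s ->
     c <= #|[set v in W | all (adj G v) s]%SET|%:R) ->
  forall q, (q <= k.+1)%N -> c ^+ q <= #|clique_tuples W q|%:R.
Proof.
move=> c0 h; elim=> [|q IH] qk.
  rewrite expr0 ler1n; apply/card_gt0P; exists [tuple].
  by rewrite inE.
have {}IH := IH (ltnW qk).
rewrite -sum_card_cons; under eq_bigr do rewrite card_set_sum.
rewrite exchange_big /= natr_sum exprSr.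
apply: le_trans (ler_wpM2r c0 IH) _.
rewrite -[#|_|%:R]mulr_natl mulr1 -[#|_| in leLHS]sum1_card natr_sum mulr_suml big_mkcond /=.
apply: ler_sum => s _; case: ifPn => [|_]; last by rewrite ler0n.
rewrite inE => /andP[sW scl]; rewrite mul1r.
apply: le_trans (h s _ sW) _; first by rewrite size_tuple.
rewrite card_set_sum ler_nat leq_sum// => v _.
by rewrite inE /= sW scl andbT; case: (v \in W) (all _ _) => [][].
Qed.

End InGraph.

(** Pass to a linear-sized [W] of minimum degree about [(1 - 1/k + d/2) #|W|]; there any [k]
    vertices have linearly many common neighbours, and cliques are built greedily. *)
Lemma supersaturation (k : nat) (d : R) : (0 < k)%N -> 0 < d <= 1 ->
  exists D n0 : nat, forall (V : finType) (G : sgraph V), (n0 <= #|V|)%N ->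
    (1 - k%:R^-1 + d) * #|V|%:R ^+ 2 <= (2 * #|edges G|)%:R ->
  exists E : {set k.+1.-tuple V},
    {in E, forall s : k.+1.-tuple V, pairwise (adj G) s} /\
    (#|V| ^ k.+1 <= D * #|E|)%N.
Proof.
move=> k0 /andP[d0 d1].
have kR : (0 : R) < k%:R by rewrite ltr0n.
have k1 : (1 : R) <= k%:R by rewrite ler1n.
have kV1 : k%:R^-1 <= 1 :> R by rewrite invf_le1.
have kV0 : 0 < k%:R^-1 :> R by rewrite invr_gt0.
pose D0 := (Num.trunc (8 / d ^+ 2)).+1.
have D0P : 8 / d ^+ 2 <= D0%:R by apply: ltW; apply: truncnS_gt.
have d20 : 0 < d ^+ 2 by rewrite exprn_gt0.
exists (D0 ^ k.+1)%N, D0 => V G nV edgesG.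
(* Half of the excess [d] is kept for the minimum degree; the other half forces [W] to be large. *)
pose beta : R := 1 - k%:R^-1 + d / 2.
have beta0 : 0 <= beta by rewrite /beta; lra.
have beta2 : beta <= 2 by rewrite /beta; lra.
have [W [WPhi Wdeg]] := min_degree_set G beta.
set n : R := #|V|%:R in edgesG WPhi *.
set w : R := #|W|%:R in WPhi Wdeg *.
have nD : D0%:R <= n by rewrite ler_nat.
have n0 : 0 < n by rewrite (lt_le_trans _ nD)// ltr0n.
have wn : w <= n by rewrite ler_nat max_card.
have w0 : 0 <= w by rewrite ler0n.
have degw v : (\sum_(y in W) adj G v y)%:R <= w.
  rewrite ler_nat -sum1_card; apply: leq_sum => y _; exact: leq_b1.
have pairsw : (\sum_(x in W) \sum_(y in W) adj G x y)%:R <= w * w.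
  rewrite natr_sum (_ : w * w = \sum_(x in W) w); last first.
    by rewrite sumr_const -mulr_natl.
  by apply: ler_sum => x _; apply: degw.
have pairsT : (\sum_(x in [set: V]%SET) \sum_(y in [set: V]%SET) adj G x y)%N =
    (2 * #|edges G|)%N.
  rewrite -sum_adj; apply: eq_big => [x|x _]; rewrite ?inE//.
  by rewrite card_set_sum; apply: eq_bigl => y; rewrite inE.
rewrite pairsT in WPhi.
have wlarge : d / 2 * n <= w.
  rewrite -(ler_pM2r n0).
  have : d / 2 * n ^+ 2 <= w * w.
    have bw : 0 <= beta * w ^+ 2 by rewrite mulr_ge0// sqr_ge0.
    have : (1 - k%:R^-1 + d) * n ^+ 2 = beta * n ^+ 2 + d / 2 * n ^+ 2.
      by rewrite /beta; lra.
    lra.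
  rewrite expr2 mulrA => /le_trans; apply.
  by rewrite ler_wpM2l.
pose f := w - beta * (w - 1 / 2).
have f0 : 0 < w -> 0 <= f.
  rewrite ltr0n => /card_gt0P[v /Wdeg h].
  by rewrite subr_ge0 (le_trans h).
(* This is [w - k * f]. Since [w >= d n / 2], it is at least [d^2 n / 8] once [d^2 n >= 8], which
   explains [D0]. *)
pose c := k%:R / 2 * (d * w - beta).
have nc : n <= D0%:R * c.
  have c1 : d ^+ 2 * n / 8 <= c.
    have dn8 : 8 <= d ^+ 2 * n.
      by rewrite mulrC -ler_pdivrMr// (le_trans D0P).
    have : 2^-1 * (d * w - beta) <= c.
      rewrite /c -[in leRHS]mulrA ler_peMl//.
      have : d * (d / 2 * n) <= d * w by rewrite ler_pM2l.
      nra.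
    have : d * (d / 2 * n) <= d * w by rewrite ler_pM2l.
    nra.
  have c0' : 0 <= c by rewrite (le_trans _ c1)// divr_ge0// mulr_ge0// ltW.
  apply: le_trans (ler_wpM2r c0' D0P).
  rewrite mulrAC ler_pdivlMr//; nra.
have c0 : 0 <= c.
  by rewrite -(@pmulr_rge0 _ D0%:R) ?ltr0n// (le_trans _ nc)// ltW.
exists (clique_tuples G W k.+1); split.
  by move=> s; rewrite inE => /andP[].
rewrite -(ler_nat R) natrM !natrX -/n.
apply: (le_trans (y := (D0%:R * c) ^+ k.+1)); first by rewrite lerXn2r// nnegrE ltW// (lt_le_trans n0).
rewrite exprMn ler_wpM2l// ?exprn_ge0//.
apply: card_clique_tuples (leqnn _) => // s sk sW.
have w1 : 0 < w by rewrite (lt_le_trans _ wlarge)// !mulr_gt0.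
apply: le_trans (@common_nbhd V G W f s _ sW) => [|v vW].
  have : (size s)%:R * f <= k%:R * f by rewrite ler_wpM2r ?f0// ler_nat.
  suff -> : c = w - k%:R * f by rewrite -/w; lra.
  by rewrite /c /f /beta; field; rewrite gt_eqF.
by rewrite -/w /f opprB addrC subrK; apply: Wdeg.
Qed.

End Supersaturation.

(** * Cliques in dense graphs of small independence number *)


Section DenseGraphs.
Local Open Scope nat_scope.

(** The independence bound enters here: a [K_t]-free [U] would give [Q t u <= alpha G], and
    subadditivity would then contradict the bound on [r * alpha G]. *)
Lemma clique_in_large_set (V : finType) (G : sgraph V) (t r u : nat) (U : {set V}) :
  2 <= t -> #|V| <= r * u -> r * alpha G < Q t #|V| -> u <= #|U| ->
  exists S : {set V}, [/\ S \subset U, is_clique G S & #|S| = t].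
Proof.
move=> t2 Vru alphaG uU; apply/not_existsP => nS.
suff : Q t #|V| <= r * alpha G by rewrite leqNgt alphaG.
apply: leq_trans (Q_subadd t2 Vru) _; rewrite leq_mul2l; apply/orP; right.
apply: (Q_leq_alpha uU) => S SU Scl; rewrite ltnNge; apply/negP => tS.
have [f finj fS] := ord_inj_set tS.
apply: (nS [set f x | x in 'I_t]%SET); split.
- by apply/fintype.subsetP => _ /imsetP[x _ ->]; apply: (fintype.subsetP SU).
- by move=> _ _ /imsetP[x _ ->] /imsetP[y _ ->]; apply: Scl.
- by rewrite card_imset// card_ord.
Qed.

(** [z] is the integer part of [(log n)^(1/N)], so that later estimates stay in the natural
    numbers. *)
Lemma expn_sandwich N n : 0 < N -> 0 < n ->
  exists z, 2 ^ (z ^ N) <= n < 2 ^ (z.+1 ^ N).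
Proof.
move=> N0 n0; have ex0 : exists z, 2 ^ (z ^ N) <= n by exists 0; rewrite exp0n.
have bnd z : 2 ^ (z ^ N) <= n -> z <= n.
  move=> h; apply: leq_trans h; apply: (@leq_trans (z ^ N)).
    by rewrite -[leqLHS]expn1; case: z => // z; rewrite leq_pexp2l.
  by apply: ltnW; apply: ltn_expl.
case: (ex_maxnP ex0 bnd) => z zn zmax; exists z; rewrite zn /= ltnNge.
by apply/negP => /zmax; rewrite ltnn.
Qed.

(* [z] is about [(log n)^(1/N)]; cliques of size [j] need density [2^-x(j)], and
   samples of size [m = z^(N-1) / x(j+1)] cost a factor [2^(-O(z^(N-1)))] in vertices,
   while [x(j) m = z^(N+1)] exceeds [t log n]. *)
Lemma blowup_parameters (t q z n : nat) (N := 2 * q + 2) (M := 2 ^ (5 * z ^ N.-1))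
    (x := fun j => z ^ (2 * (q - j)).+1) :
  t * 2 ^ N + 6 <= z -> 2 ^ (z ^ N) <= n < 2 ^ (z.+1 ^ N) ->
  n <= 2 * M * (n.-1 %/ M) /\
  forall j, j < q -> exists m,
    (n.-1 %/ M) * 2 ^ ((x j.+1).+1 * m.+1).+1 < n /\
    n ^ t * 2 ^ ((x j.+1).+1 * m.+1).+1 <= 2 ^ (x j * m).
Proof.
move=> zlarge /andP[zn nz].
have z0 : 0 < z by lia.
have M0 : 0 < M by rewrite expn_gt0.
have NE : N = N.-1.+1 by rewrite /N addn2.
have Mn : 2 * M <= n.
  apply: leq_trans zn; rewrite /M -expnS leq_exp2l// {2}NE expnS.
  have : 0 < z ^ N.-1 by rewrite expn_gt0 z0.
  nia.
have n0 : 0 < n by lia.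
(* Dividing [n - 1] rather than [n] makes [u * M < n] strict for [u = n.-1 %/ M]; the remainder is
   absorbed in the factor 2 because [u >= 1]. *)
have nE : n.-1 = (n.-1 %/ M) * M + n.-1 %% M by apply: divn_eq.
have nM : n.-1 %% M < M by rewrite ltn_mod.
have u1 : 0 < n.-1 %/ M by rewrite divn_gt0//; lia.
split; first by nia.
move=> j jq; exists (z ^ (N.-1 - (2 * (q - j.+1)).+1)).
set a := (2 * (q - j.+1)).+1; have aN : a <= N.-1 by rewrite /a /N; lia.
have xSj : x j.+1 = z ^ a by [].
have xj : x j = z ^ a.+2 by rewrite /x /a; congr (_ ^ _); lia.
rewrite xSj xj -expnD (_ : a.+2 + (N.-1 - a) = N.+1); last by lia.
(* Expanding the left side gives five terms, each at most [z ^ N.-1]: the origin of the 5 in [M]. *)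
have small : (((z ^ a).+1 * (z ^ (N.-1 - a)).+1).+1 <= 5 * z ^ N.-1).
  have : z ^ a * z ^ (N.-1 - a) = z ^ N.-1 by rewrite -expnD subnKC.
  have : 0 < z ^ a by rewrite expn_gt0 z0.
  have : 0 < z ^ (N.-1 - a) by rewrite expn_gt0 z0.
  nia.
split.
  apply: (@leq_ltn_trans (n.-1 %/ M * M)); last by lia.
  by rewrite leq_mul2l leq_exp2l// small orbT.
apply: (@leq_trans (2 ^ (z.+1 ^ N * t + 5 * z ^ N.-1))).
  rewrite expnD expnM leq_mul ?leq_exp2l//.
  by apply: leq_expr2; apply: ltnW.
rewrite leq_exp2l//.
have h1 : z.+1 ^ N <= 2 ^ N * z ^ N by rewrite -expnMn leq_expr2//; lia.
have h2 : 5 * z ^ N.-1 <= z ^ N by rewrite {2}NE expnS leq_mul2r; lia.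
by rewrite expnS; nia.
Qed.

Lemma dense_contains_K (R : realType) (t k : nat) (d : R) : 2 <= t -> 0 < k ->
  (0 < d <= 1)%R ->
  exists z0, forall z (V : finType) (G : sgraph V), z0 <= z ->
    2 ^ (z ^ (2 * k + 4)) <= #|V| < 2 ^ (z.+1 ^ (2 * k + 4)) ->
    2 ^ (5 * z ^ (2 * k + 3)).+1 * alpha G < Q t #|V| ->
    ((1 - k%:R^-1 + d) * #|V|%:R ^+ 2 <= (2 * #|edges G|)%:R :> R)%R ->
  contains (K (t * k.+1)) G.
Proof.
move=> t2 k0 d01; have [D [n0 sat]] := supersaturation k0 d01.
exists (t * 2 ^ (2 * k + 4) + 6 + D + n0) => z V G zlarge nz alphaG edgesG.
have [|E [Ecl Edens]] := sat V G _ edgesG.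
  have /andP[zn _] := nz; apply: leq_trans zn.
  apply: leq_trans (ltnW (ltn_expl _ _)) => //.
  apply: (@leq_trans z); first by lia.
  by rewrite -[leqLHS]expn1 leq_pexp2l//; lia.
have NE : 2 * k + 4 = 2 * k.+1 + 2 by lia.
have NE' : 2 * k + 3 = (2 * k.+1 + 2).-1 by lia.
rewrite NE NE' in zlarge nz alphaG.
have [|nu params] := blowup_parameters (t := t) (q := k.+1) _ nz; first by lia.
have [||| S [Scl St _]] := clique_blowup (G := G) (t := t) (q := k.+1) _ _ params Ecl.
- exact: ltnW.
- by move=> U; apply: clique_in_large_set nu _; rewrite -?expnS.
(* At [j = k + 1] the exponent [x j] is [z], so the constant density [1 / D] suffices as soon as
   [z >= D]. *)
- rewrite subnn muln0 expn1; apply: leq_trans Edens _.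
  rewrite leq_mul2r; apply/orP; right; apply: (@leq_trans z); first by lia.
  exact: ltnW (ltn_expl _ _).
by apply/contains_KP; exists S => //; rewrite St.
Qed.

End DenseGraphs.

(** With exponent [1 - 1/(2N)], [log n >= z^N] yields at least [z^(N-1) * sqrt z], which exceeds
    [5 z^(N-1) + 1] once [sqrt z >= 6]. *)
Lemma weak_phi_le (R : realType) N z n : (0 < N)%N -> (36 <= z)%N ->
  (2 ^ (z ^ N) <= n)%N ->
  weak_phi ((2 * N%:R)^-1) n * (2 ^ (5 * z ^ N.-1).+1)%:R <= 1 :> R.
Proof.
move=> N0 z36 zn.
have NR : 0 < N%:R :> R by rewrite ltr0n.
have z0 : 0 < z%:R :> R by rewrite ltr0n; lia.
rewrite /weak_phi powRN mulrC ler_pdivrMr ?powR_gt0// mul1r.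
rewrite natrX -powR_mulrn// ler_powR ?ler1n//.
have ln2 : 0 < ln 2 :> R by rewrite ln_gt0// ltr1n.
have zlog : (z%:R) ^+ N <= log2 n%:R :> R.
  rewrite /log2 ler_pdivlMr// -natrX mulrC mulr_natr -lnXn ?ltr0n//.
  rewrite -natrX ler_ln ?ler_nat// posrE ltr0n ?expn_gt0//.
  by apply: leq_trans zn; rewrite expn_gt0.
have e0 : 0 <= 1 - (2 * N%:R)^-1 :> R.
  rewrite subr_ge0 invf_le1 ?mulr_gt0//.
  have : 1 <= N%:R :> R by rewrite ler1n.
  lra.
have := ge0_ler_powR e0 _ _ zlog.
rewrite !nnegrE exprn_ge0 ?(ltW z0)// => /(_ isT) h.
apply: le_trans (h _); last by rewrite (le_trans _ zlog)// exprn_ge0// ltW.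
rewrite -powR_mulrn ?(ltW z0)// -powRrM.
have -> : N%:R * (1 - (2 * N%:R)^-1) = N.-1%:R + 2^-1 :> R.
  by rewrite -[in LHS](prednK N0) -natr1; field; rewrite natr1 pnatr_eq0.
rewrite powRD; last by rewrite gt_eqF ?implybT.
rewrite powR_mulrn ?(ltW z0)// powR12_sqrt ?(ltW z0)//.
have s6 : 6 <= Num.sqrt z%:R :> R.
  rewrite -(@ler_pXn2r _ 2)// ?nnegrE// ?sqrtr_ge0// sqr_sqrtr ?(ltW z0)//.
  by rewrite -natrX ler_nat.
have zN : 1 <= z%:R ^+ N.-1 :> R by rewrite exprn_ege1// ler1n; lia.
rewrite -natr1 natrM natrX; nra.
Qed.

(** * Densities *)


Section LowerBound.
Local Open Scope nat_scope.

(** Join [k] copies of [H] completely: a clique has at most [t] vertices per copy, an independent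
    set stays in one copy, and the cross pairs alone give the edge count. *)
Lemma join_copies (k m t : nat) (H : sgraph 'I_m) : subgraph_free (K t.+1) H ->
  exists G : sgraph 'I_(k * m), [/\ subgraph_free (K (k * t).+1) G,
    alpha G <= alpha H & k * k.-1 * m ^ 2 <= 2 * #|edges G|].
Proof.
move=> /free_KP Hfree.
pose J := graph_of (fun x y : 'I_k * 'I_m => (x.1 != y.1) || adj H x.2 y.2).
have Jadj x y : adj J x y = (x.1 != y.1) || adj H x.2 y.2.
  rewrite adj_graph_of; last by move=> a b; rewrite eq_sym adjC.
  by case: (x =P y) => // ->; rewrite eqxx adjxx.
have [|f finj _] := @ord_inj_set _ [set: 'I_k * 'I_m]%SET (k * m).
  by rewrite cardsT card_prod !card_ord.
have fbij : bijective f by apply: inj_card_bij; rewrite // card_prod !card_ord.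
exists (comap J f); split.
- apply/free_KP => S Scl; rewrite ltnS.
  have [|fScl <-] := clique_image (H := J) (f := f) _ Scl.
    by move=> x y _ _; rewrite adj_comap.
  have := @leq_card_fibers _ 'I_k fst (f @: S) t; rewrite card_ord; apply => i.
  rewrite -ltnS; set F := finset _.
  suff [sndcl <-] : is_clique H (snd @: F) /\ #|snd @: F| = #|F| by apply: Hfree.
  apply: (clique_image (G := J)).
    move=> x y; rewrite !inE Jadj => /andP[_ /eqP->] /andP[_ /eqP->].
    by rewrite eqxx.
  by move=> x y; rewrite !inE => /andP[xS _] /andP[yS _]; apply: fScl.
- apply: leq_trans (alpha_comap _ finj) _; apply/alpha_leP => S /independentP Sind.
  have sndS : {in S &, forall x y, x.1 = y.1}.
    move=> x y xS yS; apply/eqP; have := Sind _ _ xS yS.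
    by rewrite Jadj negb_or negbK => /andP[].
  rewrite -(card_in_imset (f := snd)).
    apply: independent_leq_alpha.
    apply/independentP => _ _ /imsetP[x xS ->] /imsetP[y yS ->].
    by have := Sind _ _ xS yS; rewrite Jadj negb_or => /andP[].
  by move=> [x1 x2] [y1 y2] xS yS /= ->; have /= -> := sndS _ _ xS yS.
- rewrite -sum_adj.
  apply: (@leq_trans (\sum_(x : 'I_(k * m)) k.-1 * m)).
    by rewrite sum_nat_const card_ord; nia.
  apply: leq_sum => x _.
  rewrite (_ : k.-1 * m = #|f @^-1: (finset.setX [set~ (f x).1]%SET [set: 'I_m]%SET)|); last first.
    rewrite on_card_preimset; last by apply: onW_bij.
    by rewrite cardsX cardsT cardsC1 !card_ord.
  apply: subset_leq_card; apply/fintype.subsetP => y.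
  by rewrite !inE andbT adj_comap Jadj eq_sym => ->.
Qed.

(** [RT] asks for independence number strictly below the threshold, while the join only has at most
    [Q t m]; a strict increase closes this gap. If it failed from [n0] on, [Q t] would be bounded
    along [k ^ i * n1]. *)
Lemma Q_increases_often t k n0 : 2 <= t -> 2 <= k ->
  exists2 m, n0 <= m & Q t m < Q t (k * m).
Proof.
move=> t2 k2; apply/not_exists2P => nincr.
pose n1 := n0.+1.
have const i : Q t (k ^ i * n1) <= Q t n1.
  elim: i => [|i IH]; first by rewrite mul1n.
  apply: leq_trans IH; rewrite expnS -mulnA leqNgt; apply/negP.
  have [+|//] := nincr (k ^ i * n1).
  case; rewrite (leq_trans (leqnSn n0))// leq_pmull// expn_gt0; lia.
have [n nQ] := Q_unbounded (Q t n1).+1 t2.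
have nk : n <= k ^ n * n1.
  by apply: leq_trans (ltnW (ltn_expl n k2)) _; rewrite leq_pmulr.
by have := leq_trans nQ (leq_trans (Q_mono t2 nk) (const n)); rewrite ltnn.
Qed.

End LowerBound.

Section Limits.
Variable R : realType.
Implicit Types u : nat -> \bar R.

Lemma limn_esup_le_near u (C : \bar R) n0 :
  (forall n, (n0 <= n)%N -> (u n <= C)%E) -> (limn_esup u <= C)%E.
Proof.
move=> uC; apply: ge_ereal_inf; exists (ereal_sup [set u n | n in [set n | (n0 <= n)%N]]%classic).
  by exists [set n | (n0 <= n)%N]%classic => //; exists n0.
by apply: ge_ereal_sup => _ [n /= nn0 <-]; apply: uC.
Qed.

Lemma limn_esup_ge_often u (C : \bar R) :
  (forall n0, exists2 n, (n0 <= n)%N & (C <= u n)%E) -> (C <= limn_esup u)%E.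
Proof.
move=> uC; apply: le_ereal_inf_tmp => _ [V [n0 _ n0V] <-].
have [n nn0 /le_trans] := uC n0; apply.
by apply: ereal_sup_ubound; exists n => //; apply: n0V.
Qed.

End Limits.

Lemma rhotau_sup_Q_ge (R : realType) s t k : (2 <= t)%N -> (0 < k)%N ->
  ((2 <= k) ==> (k * t < s))%N ->
  (((1 - k%:R^-1) / 2)%:E <= rhotau_sup (K s) (fun n => (Q t.+1 n)%:R : R))%E.
Proof.
move=> t2 k0 kts; apply: limn_esup_ge_often => n0.
have [k2|k2] := leqP 2 k; last first.
  exists n0 => //; have -> : k = 1%N by lia.
  (* For [k = 1] the claimed lower bound is 0. *)
  by rewrite invr1 subrr mul0r lee_fin divr_ge0// exprn_ge0.
have [m n0m Qm] := @Q_increases_often t.+1 k n0.+1 (leqW t2) k2.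
exists (k * m)%N; first by nia.
have [H Hfree HQ] := Q_attained m (leqW t2 : 2 <= t.+1)%N.
have [G [Gfree Galpha Gedges]] := join_copies k Hfree.
have m0 : (0 < m)%N by lia.
rewrite lee_fin ler_pdivlMr; last by rewrite exprn_gt0// ltr0n muln_gt0 k0.
have GRT : (#|edges G| <= RT (k * m) (K s) ((Q t.+1 (k * m))%:R : R))%N.
  rewrite /RT; apply: (leq_bigmax_cond (F := fun G : sgraph 'I_(k * m) => #|edges G|)).
  rewrite ltr_nat (leq_ltn_trans Galpha) ?HQ// andbT.
  apply/free_KP => S /(free_KP _ _ Gfree); rewrite ltnS => /leq_ltn_trans; apply.
  exact: (implyP kts).
apply: (@le_trans _ _ #|edges G|%:R); last by rewrite ler_nat.
move: Gedges; rewrite -(ler_nat R) !natrM -subn1 natrB// => Gedges.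
have kR : k%:R != 0 :> R by rewrite pnatr_eq0; lia.
have -> : (1 - k%:R^-1) / 2 * (k%:R * m%:R) ^+ 2 = k%:R * (k%:R - 1) * (m%:R * m%:R) / 2 :> R.
  by field.
lra.
Qed.

Lemma log_exponent_large N z0 : (0 < N)%N -> exists n0, forall n, (n0 <= n)%N ->
  exists2 z, (z0 <= z)%N & (2 ^ (z ^ N) <= n < 2 ^ (z.+1 ^ N))%N.
Proof.
move=> N0; exists (2 ^ (z0 ^ N))%N => n nn0.
have [|z zn] := expn_sandwich N0 (n := n).
  by apply: leq_trans nn0; rewrite expn_gt0.
exists z => //; rewrite leqNgt; apply/negP => zz0.
move: zn => /andP[_]; rewrite ltnNge (leq_trans _ nn0)// leq_exp2l//.
by rewrite leq_expr2.
Qed.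

Section UpperBound.
Variable R : realType.

Lemma weak_phi_ge0 (e : R) n : 0 <= weak_phi e n.
Proof. exact: powR_ge0. Qed.

Lemma weak_phi_le1 (e : R) n : weak_phi e n <= 1.
Proof.
rewrite /weak_phi powRN invf_le1 ?powR_gt0//.
by rewrite -[leLHS](powRr0 2) ler_powR ?powR_ge0// ler1n.
Qed.

(** By [weak_phi_le] the value is at most [2^-(5 z^(N-1) + 1)], and [1 < N] makes this at most
    [1 / z]. *)
Lemma weak_phi_cvg0 N : (1 < N)%N ->
  (weak_phi ((2 * N%:R)^-1 : R) n @[n --> \oo] --> (0 : R))%classic.
Proof.
move=> N1; have N0 := ltnW N1; apply/cvgrPdist_le => e e0.
have [n0 n0P] := log_exponent_large (maxn 36 (Num.trunc e^-1).+1) N0.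
exists n0 => // n /= /n0P[z]; rewrite geq_max => /andP[z36 ze] /andP[zn _].
rewrite sub0r normrN ger0_norm ?weak_phi_ge0//.
have := weak_phi_le R N0 z36 zn.
set p := weak_phi _ _; set M := (2 ^ _)%:R => pM.
have eM : e^-1 <= M.
  apply: (@le_trans _ _ z%:R).
    by rewrite (le_trans (ltW (truncnS_gt _)))// ler_nat.
  rewrite ler_nat; apply: leq_trans (ltnW (ltn_expl z (leqnn 2))) _.
  rewrite leq_exp2l//; apply: (@leq_trans (z ^ N.-1)).
    by rewrite -[leqLHS]expn1 leq_pexp2l//; lia.
  by rewrite leqW// leq_pmull.
have M0 : 0 < M by rewrite ltr0n expn_gt0.
move: pM; rewrite -ler_pdivlMr// div1r => /le_trans; apply.
by rewrite -(invrK e) lef_pV2// posrE invr_gt0.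
Qed.

Lemma rhotau_sup_weak_le s t k (d : R) : (2 <= t)%N -> (0 < k)%N ->
  (s <= t * k.+1)%N -> 0 < d <= 1 ->
  (rhotau_sup (K s) (fun n =>
     (weak_phi ((2 * (2 * k + 4)%:R)^-1) n * (Q t n)%:R)%R) <= ((1 - k%:R^-1 + d) / 2)%:E)%E.
Proof.
move=> t2 k0 stk d01; have [z0 z0P] := dense_contains_K t2 k0 d01.
have N0 : (0 < 2 * k + 4)%N by lia.
have [n0 n0P] := log_exponent_large (maxn 36 z0) N0.
apply: (limn_esup_le_near (n0 := n0)) => n /n0P[z].
rewrite geq_max => /andP[z36 zz0] zn.
have n1 : (0 < n)%N by have /andP[+ _] := zn; apply: leq_trans; rewrite expn_gt0.
have n2 : 0 < n%:R ^+ 2 :> R by rewrite exprn_gt0// ltr0n.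
rewrite lee_fin ler_pdivrMr//.
rewrite /RT; elim/big_ind : _ => [|a b|G /andP[Gfree Galpha]].
- rewrite mulr_ge0// divr_ge0// ltW// ltr_pwDr//; first by case/andP: d01.
  by rewrite subr_ge0 invf_le1 ?ler1n ?ltr0n.
- by rewrite /maxn; case: ifP.
rewrite leNgt; apply/negP => Gedges.
move: Gfree; rewrite /subgraph_free => /negP; apply.
suff /contains_KP[S Scl St] : contains (K (t * k.+1)) G.
  by apply/contains_KP; exists S => //; apply: leq_trans St.
(* Multiplying [alpha G < phi * Q t n] by [M] and using [phi * M <= 1] gives
   [M * alpha G < Q t n]. *)
apply: z0P zz0 _ _ _; rewrite ?card_ord//.
  have /andP[zn' _] := zn; have := weak_phi_le R N0 z36 zn'.
  rewrite (_ : (2 * k + 4).-1 = 2 * k + 3)%N; last by lia.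
  rewrite -(ltr_nat R) natrM; move: Galpha.
  set p := weak_phi _ _; set M := (2 ^ _)%:R => pa pM.
  have M0 : 0 < M by rewrite ltr0n expn_gt0.
  apply: (@lt_le_trans _ _ (M * (p * (Q t n)%:R))); first by rewrite ltr_pM2l.
  by rewrite mulrA mulrC ler_piMr// mulrC.
rewrite natrM; lra.
Qed.

End UpperBound.

Theorem theorem3p8 (R : realType) (s t : nat) (hs : (2 <= s)%N)
  (ht : (2 <= t)%N) :
  phase_transition (K s) (fun n => (Q t n)%:R : R) (fun n => (Q t.+1 n)%:R : R) ->
  weak_phase_transition (K s) (fun n => (Q t n)%:R : R).
Proof.
case=> _ trans.
(* For [s <= t] the quotient is 0; the maximum then gives [k = 1], so that [1 / k] keeps its
   meaning. *)
pose k := maxn 1 (s.-1 %/ t).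
have k0 : (0 < k)%N by rewrite leq_max.
have stk : (s <= t * k.+1)%N.
  have : (s.-1 < (s.-1 %/ t).+1 * t)%N by apply: ltn_ceil; lia.
  by rewrite /k; nia.
have kts : ((2 <= k) ==> (k * t < s))%N.
  apply/implyP => k2; have kE : k = (s.-1 %/ t)%N by move: k2; rewrite /k; lia.
  by rewrite kE (leq_ltn_trans (leq_trunc_div _ _))//; lia.
exists (2 * (2 * k + 4)%:R)^-1; split.
  by rewrite invr_gt0 mulr_gt0// ltr0n; lia.
split; first by apply: weak_phi_cvg0; lia.
split=> [n|]; first by rewrite ler_piMl// weak_phi_le1.
apply: le_lt_trans trans; apply: le_trans (rhotau_sup_Q_ge R ht k0 kts).
(* The upper bound holds for every excess [d] in [(0, 1]]; letting it shrink brings the upper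
   density down to [(1 - 1/k) / 2]. *)
apply/lee_addgt0Pr => e e0.
apply: le_trans (rhotau_sup_weak_le (d := Num.min 1 e) ht k0 stk _) _.
  by rewrite lt_min ltr01 e0 ge_min lexx.
rewrite -EFinD lee_fin.
have : Num.min 1 e <= e by rewrite ge_min lexx orbT.
lra.
Qed.
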